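(* There is no prime element in the semiring of sums of cycles: there is no non-empty sum of cycles $X\neq C_1$ such that, for all sums of cycles $A,B$, $X\mid AB$ implies $X\mid A$ or $X\mid B$.
   Context: A sum of cycles is a finite digraph that is a disjoint union of directed cycles, considered up to isomorphism. $C_\ell$ is the directed cycle of length $\ell$. The sum $A+B$ is disjoint union, and the product $AB$ is the direct product of digraphs, i.e. the distributive product with $C_aC_b=\gcd(a,b)\,C_{\operatorname{lcm}(a,b)}$ (where $nC_\ell$ denotes $n$ disjoint copies of $C_\ell$). For sums of cycles, $A\mid B$ means that there is a sum of cycles $X$ with $AX=B$. *)

(* Defs.v *)
From mathcomp Require Import all_boot.

Set Implicit Arguments.
Unset Strict Implicit.
Unset Printing Implicit Defensive.

Record digraph := Digraph { vertex :> finType; edge : rel vertex }.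

Definition iso (G H : digraph) : Prop :=
  exists2 f : G -> H, bijective f & forall x y, edge (f x) (f y) = edge x y.

Definition empty_digraph : digraph := @Digraph void (fun _ _ => false).

Definition digraph_add (G H : digraph) : digraph :=
  @Digraph (G + H)%type (fun u v =>
    match u, v with
    | inl x, inl y => edge x y
    | inr x, inr y => edge x y
    | _, _ => false
    end).

Definition digraph_mul (G H : digraph) : digraph :=
  @Digraph (G * H)%type (fun u v => edge u.1 v.1 && edge u.2 v.2).

(* Only meaningful for l > 0 (the digraph is empty for l = 0); Cycle 1 is a
   single vertex with a loop. *)
Definition Cycle (l : nat) : digraph :=
  @Digraph 'I_l (fun i j => val j == i.+1 %% l).

Definition disjoint_cycles (s : seq nat) : digraph :=
  foldr (fun l G => digraph_add (Cycle l) G) empty_digraph s.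

(* The sums of cycles are the elements of this class, taken up to [iso]: below,
   equality of sums of cycles is rendered by [iso]. The empty sum is included. *)
Definition sum_of_cycles (G : digraph) : Prop :=
  exists2 s : seq nat, all (fun l => 0 < l) s & iso G (disjoint_cycles s).

Definition divides (A B : digraph) : Prop :=
  exists2 X : digraph, sum_of_cycles X & iso (digraph_mul A X) B.

Definition prime_sum (X : digraph) : Prop :=
  [/\ sum_of_cycles X,
      0 < #|vertex X|,
      ~ iso X (Cycle 1)
    & forall A B : digraph, sum_of_cycles A -> sum_of_cycles B ->
        divides X (digraph_mul A B) -> divides X A \/ divides X B].

(* Main.v *)
Require Import Defs.
From mathcomp Require Import all_boot.

(** A sum of cycles is a finite set with a permutation, and a prime would have
    to split the following identity: if the [n]-th powers of the permutations
    of [G] and [H] are trivial and [G], [H] have equally many vertices, then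
    [G * C_n] and [C_n * H] are isomorphic ([mul_cycle_iso]), since multiplying
    by such a [C_n] untwists both permutations.

    Let [X] be prime, with [N] vertices and with a permutation whose [m]-th
    power is trivial.  Taking [n = m ^ 2] and [H] the sum of [N] loops,
    [X] divides [C_n * H].
    - [X] does not divide [C_n], because a divisor of [C_n] whose [m]-th power
      is trivial, with [m ^ 2] dividing [n], is [C_1] ([divides_cycle_trivial]).
    - Hence [X] divides [H], which forces [X] to consist of [N] loops.
    But then the same identity with [n = N] and [H = C_N] shows that [X]
    divides [C_N * C_N], so [X] divides [C_N], and the same lemma with [m = 1]
    gives [X = C_1], which is excluded. *)

Set Implicit Arguments.
Unset Strict Implicit.
Unset Printing Implicit Defensive.

Definition steps_by (G : digraph) (g : G -> G) : Prop :=
  forall x y : G, edge x y = (y == g x).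

Lemma cycle_steps n : @steps_by (Cycle n) (@ordS n).
Proof. by move=> i j; rewrite -val_eqE. Qed.

Lemma val_iter_ordS n t (i : 'I_n) : val (iter t (@ordS n) i) = (i + t) %% n.
Proof.
elim: t => [|t IH]; first by rewrite addn0 modn_small.
by rewrite iterS /= IH -addn1 modnDml addn1 addnS.
Qed.

Lemma iter_ordS_id n t (i : 'I_n) : (iter t (@ordS n) i == i) = (n %| t).
Proof.
rewrite -val_eqE val_iter_ordS -[X in _ == X](modn_small (ltn_ord i)).
by rewrite -[in X in _ == X](addn0 i) eqn_modDl mod0n.
Qed.

Lemma disjoint_cycles_steps (s : seq nat) m : all (fun l => l %| m) s ->
  exists2 g : disjoint_cycles s -> disjoint_cycles s,
    steps_by g & iter m g =1 id.
Proof.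
elim: s => [_|l s IH /= /andP[lm /IH[g gE gm]]]; first by exists id; case.
pose g' (u : Cycle l + disjoint_cycles s) : Cycle l + disjoint_cycles s :=
  match u with inl i => inl (ordS i) | inr x => inr (g x) end.
have g'l t i : iter t g' (inl i) = inl (iter t (@ordS l) i).
  by elim: t => //= t ->.
have g'r t x : iter t g' (inr x) = inr (iter t g x) by elim: t => //= t ->.
exists g'.
  by move=> [i|x] [j|y] /=.
case=> [i|x]; last by rewrite g'r gm.
by rewrite g'l; congr inl; apply/eqP; rewrite iter_ordS_id.
Qed.

Lemma card_disjoint_cycles (s : seq nat) : #|disjoint_cycles s| = sumn s.
Proof.
elim: s => [|l s IH] /=; first exact: card_void.
by rewrite card_sum card_ord IH.
Qed.

Lemma iso_steps (G H : digraph) (h : H -> H) m :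
    iso G H -> steps_by h -> iter m h =1 id ->
  exists2 g : G -> G, steps_by g & iter m g =1 id.
Proof.
case=> f [f' fK f'K] fE hE hm.
have itE t x : iter t (f' \o h \o f) x = f' (iter t h (f x)).
  by elim: t => [|t IH] /=; rewrite ?fK // IH f'K.
exists (f' \o h \o f) => [x y|x]; last by rewrite itE hm fK.
by rewrite -fE hE /= -(can2_eq fK f'K).
Qed.

Lemma sum_of_cycles_steps (G : digraph) : sum_of_cycles G ->
  exists m (g : G -> G), [/\ 0 < m, steps_by g & iter m g =1 id].
Proof.
case=> s s_gt0 isoGs; pose m := \prod_(l <- s) l.
have m_gt0 : 0 < m by rewrite /m big_seq prodn_cond_gt0 // => l /(allP s_gt0).
have dvd_m : all (fun l => l %| m) s.
  by apply/allP=> l ls; rewrite /m (big_rem l) //= dvdn_mulr.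
have [h hE hm] := disjoint_cycles_steps dvd_m.
by have [g gE gm] := iso_steps isoGs hE hm; exists m, g.
Qed.

Lemma sum_of_cycles_cycle n : 0 < n -> sum_of_cycles (Cycle n).
Proof.
move=> n_gt0; exists [:: n] => /=; first by rewrite n_gt0.
exists inl => //.
exists (fun u => match u with inl i => i | inr v => of_void _ v end) => //.
by case=> // -[].
Qed.

(** The isomorphism undoes the permutation of [G] and applies that of [H]:
    over the [i]-th vertex of the cycle, it rewinds [G] by [i] steps (that is,
    advances it by [n - i]), transports along any bijection of the vertex sets,
    and advances [H] by [i] steps.  Going once around the cycle is consistent
    because both [n]-th powers are trivial. *)
Lemma mul_cycle_iso (G H : digraph) (g : G -> G) (h : H -> H) n :
    steps_by g -> steps_by h -> iter n g =1 id -> iter n h =1 id ->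
    #|G| = #|H| ->
  iso (digraph_mul G (Cycle n)) (digraph_mul (Cycle n) H).
Proof.
move=> gE hE gn hn cardGH.
have [phi [psi phiK psiK]] : exists phi : G -> H, bijective phi.
  exists (fun x => enum_val (cast_ord cardGH (enum_rank x))).
  exists (fun y => enum_val (cast_ord (esym cardGH) (enum_rank y))) => x;
    by rewrite enum_valK ?cast_ordK ?cast_ordKV enum_rankK.
pose P (i : 'I_n) x := iter i h (phi (iter (n - i) g x)).
pose Q (i : 'I_n) y := iter i g (psi (iter (n - i) h y)).
have PK i : cancel (P i) (Q i).
  by move=> x; rewrite /P /Q -iterD subnK ?hn ?phiK -?iterD ?subnKC ?gn // ltnW.
have QK i : cancel (Q i) (P i).
  by move=> y; rewrite /P /Q -iterD subnK ?gn ?psiK -?iterD ?subnKC ?hn // ltnW.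
have Pstep i x : P (ordS i) (g x) = h (P i x).
  rewrite /P /= -iterS -iterSr; have := ltn_ord i.
  rewrite leq_eqVlt => /predU1P[iS|iS]; last by rewrite modn_small // subnSK.
  (* The step from the last vertex of the cycle back to the first. *)
  have i_last : n - i = 1 by rewrite -[X in X - _]iS subSnn.
  by rewrite iS modnn subn0 /= gn hn i_last.
exists (fun u => (u.2, P u.2 u.1)).
  by exists (fun v => (Q v.1 v.2, v.1)) => -[a b] /=; rewrite ?PK ?QK.
move=> [x i] [y j] /=; rewrite andbC -!/(edge _ _) gE hE.
have [ji|_] := eqVneq (val j) (i.+1 %% n); last by rewrite !andbF.
have -> : j = ordS i by apply: val_inj.
by rewrite !andbT -Pstep; apply/inj_eq/can_inj/PK.
Qed.

(** Every [x'] in [X] occurs in the same fibre as [x], so that some power [t]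
    of the permutation of [C_n] moves [x] to [x'] and fixes the other
    coordinate.  Its [m]-th power fixes both coordinates, so [n] divides
    [t * m]; as [m ^ 2] divides [n], [m] divides [t] and [x' = x]. *)
Lemma divides_cycle_trivial (X : digraph) (g : X -> X) m n :
    steps_by g -> iter m g =1 id -> 0 < m -> 0 < n -> m ^ 2 %| n ->
  divides X (Cycle n) -> iso X (Cycle 1).
Proof.
move=> gE gm m_gt0 n_gt0 mn [Y /sum_of_cycles_steps[_ [h [_ hE _]]]].
case=> F [F' FK F'K] FE.
have Fstep t x y : F (iter t g x, iter t h y) = iter t (@ordS n) (F (x, y)).
  elim: t => //= t <-; apply/eqP.
  by rewrite -(cycle_steps (F (iter t g x, iter t h y))) FE /= gE hE !eqxx.
have gmM t x : iter (t * m) g x = x.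
  by elim: t x => // t IH x; rewrite mulSn iterD IH gm.
have [x y] := F' (Ordinal n_gt0).
have X1 x' : x' = x.
  have [t Ft] : exists t, iter t (@ordS n) (F (x, y)) = F (x', y).
    exists (n - F (x, y) + F (x', y)); apply/val_inj.
    rewrite val_iter_ordS addnA subnKC; last exact/ltnW/ltn_ord.
    by rewrite modnDl modn_small.
  have /(can_inj FK)[gt ht] := etrans (Fstep t x y) Ft.
  have htM k : iter (k * t) h y = y by elim: k => // k IH; rewrite mulSn iterD IH.
  have : n %| t * m.
    by rewrite -(iter_ordS_id _ (F (x, y))) -Fstep gmM mulnC htM.
  move/(dvdn_trans mn); rewrite -mulnn dvdn_pmul2r // => /dvdnP[k tE].
  by rewrite -gt tE gmM.
exists (fun _ => ord0 : 'I_1).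
  by exists (fun _ => x) => [z|i]; rewrite ?ord1 // (X1 z).
by move=> z z'; rewrite gE (X1 z') (X1 (g z)) eqxx.
Qed.

(** A product step leads from [(x, y)] to [(g x, h y)]; in a digraph whose only
    edges are loops these two must be equal. *)
Lemma divides_loops (X H : digraph) (g : X -> X) : 0 < #|H| ->
  steps_by g -> @steps_by H id -> divides X H -> g =1 id.
Proof.
move=> /card_gt0P[v _] gE HE [Y /sum_of_cycles_steps[_ [h [_ hE _]]]].
case=> F [F' FK F'K] FE x; have [_ y] := F' v.
have : edge (F (x, y)) (F (g x, h y)) by rewrite FE /= gE hE !eqxx.
by rewrite HE => /eqP/(can_inj FK)[].
Qed.

Theorem proposition2 : ~ exists X : digraph, prime_sum X.
Proof.
case=> X [/sum_of_cycles_steps[m [g [m_gt0 gE gm]]] X_gt0 X_neq1 X_prime].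
pose N := #|X|; pose s := nseq N 1.
have s_dvd1 : all (fun l => l %| 1) s by rewrite all_nseq orbT.
have [k kE k1] := disjoint_cycles_steps s_dvd1.
have cardL : #|disjoint_cycles s| = N.
  by rewrite card_disjoint_cycles sumn_nseq mul1n.
have LE : @steps_by (disjoint_cycles s) id.
  by move=> x y; rewrite kE -[k x]/(iter 1 k x) k1.
have iter_id (T : Type) t : iter t (@id T) =1 id by elim: t.
have L_sum : sum_of_cycles (disjoint_cycles s).
  by exists s; [rewrite all_nseq orbT | exists id => //; exists id].
have m2_gt0 : 0 < m ^ 2 by rewrite expn_gt0 m_gt0.
have gm2 : iter (m ^ 2) g =1 id.
  rewrite -mulnn => x; elim: {1}m => // t IH.
  by rewrite mulSn iterD IH gm.
have XdvdL : divides X (disjoint_cycles s).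
  have C_sum := sum_of_cycles_cycle m2_gt0.
  suff /(X_prime _ _ C_sum L_sum)[XdvdC|//] :
      divides X (digraph_mul (Cycle (m ^ 2)) (disjoint_cycles s)).
    by case: X_neq1; apply: (divides_cycle_trivial gE gm m_gt0 m2_gt0) XdvdC.
  by exists (Cycle (m ^ 2)) => //; apply: (mul_cycle_iso gE LE).
have g_id : g =1 id by apply: divides_loops XdvdL; rewrite // cardL.
have XdvdN : divides X (Cycle N).
  have CN_sum := sum_of_cycles_cycle X_gt0.
  suff /(X_prime _ _ CN_sum CN_sum)[] :
    divides X (digraph_mul (Cycle N) (Cycle N)) by [].
  exists (Cycle N) => //; apply: (mul_cycle_iso gE (@cycle_steps N)).
  - by move=> x; rewrite (eq_iter g_id) iter_id.
  - by move=> i; apply/eqP; rewrite iter_ordS_id.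
  - by rewrite card_ord.
by apply/X_neq1/(divides_cycle_trivial gE (m := 1) g_id _ X_gt0) => //.
Qed.
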